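(* For every integer $n \ge 0$ and every real $\ell > 0$ there exist a function $h_{n,\ell}$ on $\{y\in\mathbb{R} : y > \ell/2\}$ and a real number $\nu_{n,\ell}$ such that for every integer $m \ge 1$ the following hold. (1) If $a > \nu_{m,\ell}$, then the equation $h_{m,\ell}(y) - a = 0$ has exactly two solutions $y_{a,m,\ell}^{-} < y_{a,m,\ell}^{+}$ (both in $(\ell/2,\infty)$, hence positive). (2) If $a > \nu_{m,\ell}$, then for each choice of sign $\pm$, setting $y_n = h_{n,\ell}(y_{a,m,\ell}^{\pm})$ for $n = 0,\dots,m-1$, the PTC surface $$D_{2m+1,\ell}(a, y_{m-1}, y_{m-2}, \dots, y_0, y_0, \dots, y_{m-2}, y_{m-1}, a)$$ is minimal. Moreover, for all $n\ge 0$ and $y > \ell/2$, $$h_{n,\ell}(y) = y\,V_n\!\left(1 + \frac{2\ell^2}{4y^2-\ell^2}\right) = y\,F\!\left(n+1, -n; \tfrac12; \frac{-\ell^2}{4y^2-\ell^2}\right) = \frac{(2y+\ell)^{2n+1} + (2y-\ell)^{2n+1}}{4(4y^2-\ell^2)^n}.$$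
   Context: For $\ell>0$ and $x_0,x_1>0$ put $S_{1,\ell}(x_0,x_1) = (x_0+x_1)\sqrt{(x_1-x_0)^2+\ell^2}$; $\pi S_{1,\ell}(x_0,x_1)$ is the lateral area of the truncated cone $D_{1,\ell}(x_0,x_1)$ of height $\ell$ whose circular edges have radii $x_0,x_1$ (the discs bounded by these circles are not included). For $x_0,\dots,x_N>0$, $D_{N,\ell}(x_0,\dots,x_N)$ is the surface obtained by attaching successively $D_{1,\ell}(x_0,x_1), D_{1,\ell}(x_1,x_2),\dots,D_{1,\ell}(x_{N-1},x_N)$ along the common circles; it is called a piecewise truncated conical (PTC) surface. Its area is $\pi S_{N,\ell}(x_0,\dots,x_N)$ where $S_{N,\ell}(x_0,\dots,x_N) = \sum_{i=1}^N S_{1,\ell}(x_{i-1},x_i)$. For fixed $a,b>0$ and $k \ge 0$, a PTC surface $D_{k+2,\ell}(a,x_0^{(0)},\dots,x_k^{(0)},b)$ is called minimal if $(x_0^{(0)},\dots,x_k^{(0)})$ is a critical point of the function $(x_0,\dots,x_k)\mapsto S_{k+2,\ell}(a,x_0,\dots,x_k,b)$ of the $k+1$ positive interior radii (boundary radii $a,b$ being fixed). $V_n$ is the Chebyshev polynomial of the third kind: $V_0(x)=1$, $V_1(x)=2x-1$, $V_n(x)=2xV_{n-1}(x)-V_{n-2}(x)$ for $n\ge2$. $F(\alpha,\beta;\gamma;x)=\sum_{i\ge 0}\frac{(\alpha)_i(\beta)_i}{(\gamma)_i(1)_i}x^i$ is the Gauss hypergeometric series, with $(\alpha)_i=\alpha(\alpha+1)\cdots(\alpha+i-1)$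 (for $\beta=-n$ the series is a finite sum). *)

(* Defs.v *)
From mathcomp Require Import all_boot all_order all_algebra.
From mathcomp Require Import all_classical all_reals all_analysis.

Set Implicit Arguments.
Unset Strict Implicit.
Unset Printing Implicit Defensive.

Import Order.TTheory GRing.Theory Num.Theory.
Import numFieldNormedType.Exports.

Local Open Scope classical_set_scope.
Local Open Scope ring_scope.

(* pi * S1 l x0 x1 is the lateral area of the truncated cone of height l with
   end radii x0 and x1; pi * SN N l x is the area of the PTC surface with radii
   x 0, ..., x N. *)
Definition S1 (R : realType) (l x0 x1 : R) : R :=
  (x0 + x1) * Num.sqrt ((x1 - x0) ^+ 2 + l ^+ 2).

(* Only the values x 0, ..., x N are used. *)
Definition SN (R : realType) (N : nat) (l : R) (x : nat -> R) : R :=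
  \sum_(1 <= i < N.+1) S1 l (x i.-1) (x i).

(* The radii a, x_0, ..., x_k, b, listed from index 0 to index k + 2. *)
Definition radii (R : realType) (k : nat) (a : R) (x : 'rV[R]_k.+1) (b : R) :
    nat -> R :=
  nth 0 (a :: rcons [seq x ord0 j | j <- enum 'I_k.+1] b).

Definition critical_point (R : realType) (k : nat) (f : 'rV[R]_k.+1 -> R)
    (x : 'rV[R]_k.+1) : Prop :=
  differentiable f x /\ forall v, 'd f x v = 0.

(* D_{k+2,l}(a, x_0, ..., x_k, b) is a PTC surface (all radii are positive)
   and is minimal. The positive orthant is open in R^(k+1) and SN is given by
   the same formula on the whole space, so being critical on the orthant is
   being critical on R^(k+1). *)
Definition minimal_PTC (R : realType) (k : nat) (l a : R) (x : 'rV[R]_k.+1)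
    (b : R) : Prop :=
  [/\ 0 < l, 0 < a, 0 < b, forall j, 0 < x ord0 j &
      critical_point (fun z => SN k.+2 l (radii a z b)) x].

(* y_{m-1}, ..., y_0, y_0, ..., y_{m-1}: for m >= 1 these are the k + 1 = 2m
   interior radii of D_{2m+1,l}, with k = (2 * m).-1. For m = 0 the dimension
   is 1 and the vector is not meaningful. *)
Definition mirror (R : realType) (m : nat) (y : nat -> R) :
    'rV[R]_(2 * m).-1.+1 :=
  \row_j (rev (mkseq y m) ++ mkseq y m)`_j.

Fixpoint chebyshev3 (R : realType) (n : nat) : {poly R} :=
  match n with
  | 0 => 1
  | n1.+1 =>
      match n1 with
      | 0 => 2%:R *: 'X - 1
      | n2.+1 => 2%:R *: 'X * chebyshev3 R n1 - chebyshev3 R n2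
      end
  end.

Definition rising (R : realType) (alpha : R) (i : nat) : R :=
  \prod_(0 <= j < i) (alpha + j%:R).

(* If gamma is not a nonpositive integer no denominator vanishes; if beta is a
   nonpositive integer the partial sums are eventually constant, so that the
   limit exists for every x. *)
Definition hypergeometric (R : realType) (alpha beta gamma x : R) : R :=
  limn (series (fun i =>
    rising alpha i * rising beta i / (rising gamma i * rising 1 i) * x ^+ i)).

(* Main.v *)
(* With u = 2 y + l, v = 2 y - l and r = u / v, the radii h n l y form the
   sequence l / 2 * (q + r / q) / (r - 1) for q = r ^+ n.+1, and continuing it
   to negative n mirrors it. Along this sequence the slant heights are
   l / 2 * (q + q^-1), a perfect square being hidden under the root, and the
   two contributions to each partial derivative of the area cancel.

   In terms of u and v, 4 * h m is u ^ (m+1) / v ^ m + v ^ (m+1) / u ^ m, a sum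
   of perspectives of convex functions on a line avoiding the origin: it is
   strictly convex for m >= 1, and it tends to +oo at both ends of ]l/2, +oo[.
   So any value of h m, here the one at y = l, can serve as nu m. *)
From HB Require Import structures.
Require Import Defs.
From mathcomp Require Import all_boot all_order all_algebra.
From mathcomp Require Import all_classical all_reals all_analysis.
From mathcomp Require Import ring lra zify.

Set Implicit Arguments.
Unset Strict Implicit.
Unset Printing Implicit Defensive.

Import Order.TTheory GRing.Theory Num.Theory.
Import numFieldNormedType.Exports.

Local Open Scope classical_set_scope.
Local Open Scope ring_scope.

(** * Differential of the area and a criterion for critical points *)

Lemma radii0 (R : realType) (k : nat) (a b : R) (x : 'rV[R]_k.+1) :
  radii a x b 0 = a.
Proof. by []. Qed.

Lemma radii_inner (R : realType) (k : nat) (a b : R) (x : 'rV[R]_k.+1)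
  (j : 'I_k.+1) : radii a x b j.+1 = x ord0 j.
Proof.
rewrite /radii /= nth_rcons size_map size_enum_ord ltn_ord.
by rewrite (nth_map ord0) ?size_enum_ord// nth_ord_enum.
Qed.

Lemma radii_last (R : realType) (k : nat) (a b : R) (x : 'rV[R]_k.+1) :
  radii a x b k.+2 = b.
Proof. by rewrite /radii /= nth_rcons size_map size_enum_ord ltnn eqxx. Qed.

(** Each radius is a constant or a coordinate. Setting both end radii to 0 in the differential
    covers the two cases by one formula. *)
Lemma is_diff_radii (R : realType) (k : nat) (a b : R) (x : 'rV[R]_k.+1)
    (i : nat) : (i <= k.+2)%N ->
  is_diff x (fun z => radii a z b i) (fun v => radii 0 v 0 i).
Proof.
case: i => [_|i]; first exact: is_diff_cst.
rewrite ltnS leq_eqVlt => /orP[/eqP->|ik].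
  under eq_fun do rewrite radii_last.
  under [X in is_diff_def _ _ X]eq_fun do rewrite radii_last.
  exact: is_diff_cst.
rewrite -[i]/(val (Ordinal ik)).
under eq_fun do rewrite radii_inner.
under [X in is_diff_def _ _ X]eq_fun do rewrite radii_inner.
pose f (N : 'rV[R]_k.+1) : R := N ord0 (Ordinal ik).
have flin : linear f by move=> c u v; rewrite /f !mxE.
pose fM := GRing.isLinear.Build _ _ _ _ f flin.
pose fL : {linear 'rV[R]_k.+1 -> R} := HB.pack f fM.
have fc : continuous fL by exact: coord_continuous.
rewrite (_ : (fun _ => _) = fL)//.
by split; [exact: linear_differentiable|exact: diff_lin].
Qed.

Lemma is_diff_sqrt (R : realType) (x : R) : 0 < x ->
  is_diff x Num.sqrt (fun h => h / (2 * Num.sqrt x)).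
Proof.
move=> x0; have := is_derive1_sqrt x0 => dx.
have dfx : differentiable Num.sqrt x.
  by apply/derivable1_diffP; exact: ex_derive.
split=> //; rewrite diff1E// derive1E derive_val; apply/funext => h.
by rewrite /= [LHS]mulrC [RHS]mulrC.
Qed.

(* The derivative of [S1 l x0 x1] in [x1]; by symmetry the one in [x0] is
   [dS1 l x1 x0]. *)
Definition dS1 (R : realType) (l x0 x1 : R) : R :=
  Num.sqrt ((x1 - x0) ^+ 2 + l ^+ 2) +
  (x1 ^+ 2 - x0 ^+ 2) / Num.sqrt ((x1 - x0) ^+ 2 + l ^+ 2).

Lemma is_diff_S1 (R : realType) (V : normedModType R) (l : R) (x : V)
    (f g df dg : V -> R) : 0 < l ->
  is_diff x f df -> is_diff x g dg ->
  is_diff x (fun z => S1 l (f z) (g z))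
    (fun v => dS1 l (g x) (f x) * df v + dS1 l (f x) (g x) * dg v).
Proof.
move=> l0 Df Dg; pose s z := (g z - f z) ^+ 2 + l ^+ 2.
have s0 : 0 < s x by rewrite /s ltr_wpDl ?exprn_gt0// sqr_ge0.
have Ds : is_diff x s (2 *: ((g x - f x) *: (dg - df))).
  have -> : s = (g - f) * (g - f) + cst (l ^+ 2).
    by apply/funext => z; rewrite /s expr2.
  apply: is_diff_eq; rewrite addr0; apply/funext => v /=.
  by rewrite !fctE /GRing.scale/=; ring.
have Dsqrt := @is_diff_comp _ _ _ _ _ _ _ _ _ Ds (is_diff_sqrt s0).
have -> : (fun z => S1 l (f z) (g z)) = (f + g) * (Num.sqrt \o s) by [].
apply: is_diff_eq; apply/funext => v /=.
rewrite /dS1 -[f x - g x]opprB sqrrN -/(s x) !fctE /GRing.scale/=.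
have : Num.sqrt (s x) != 0 by rewrite gt_eqF ?sqrtr_gt0.
by move=> ?; field.
Qed.

(** Each interior radius enters exactly two cones, so its partial derivative is the sum of two [dS1]
    terms. *)
Lemma critical_SN (R : realType) (k : nat) (l a b : R) (x : 'rV[R]_k.+1) :
  0 < l ->
  (forall j : nat, (j < k.+1)%N ->
     dS1 l (radii a x b j) (radii a x b j.+1) +
     dS1 l (radii a x b j.+2) (radii a x b j.+1) = 0) ->
  critical_point (fun z => SN k.+2 l (radii a z b)) x.
Proof.
move=> l0 xcrit; pose w := radii a x b.
pose T (v : 'rV[R]_k.+1) i := dS1 l (w i.+1) (w i) * radii 0 v 0 i +
  dS1 l (w i) (w i.+1) * radii 0 v 0 i.+1.
have : is_diff x (fun z => SN k.+2 l (radii a z b))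
   (fun v => \sum_(0 <= i < k.+2) T v i).
  have -> : (fun z : 'rV[R]_k.+1 => SN k.+2 l (radii a z b)) =
      (fun z => \sum_(0 <= i < k.+2) S1 l (radii a z b i) (radii a z b i.+1)).
    by apply/funext => z; rewrite /SN big_add1.
  have : (k.+2 <= k.+2)%N by [].
  (* Only the number of summands varies in the induction; the dimension of [x] stays fixed. *)
  elim: {-2}k.+2 => [_|n IH nk].
    under eq_fun do rewrite big_geq//.
    under [X in is_diff_def _ _ X]eq_fun do rewrite big_geq//.
    exact: is_diff_cst.
  under eq_fun do rewrite big_nat_recr//=.
  under [X in is_diff_def _ _ X]eq_fun do rewrite big_nat_recr//=.
  apply: is_diffD; first exact/IH/ltnW.
  by apply: is_diff_S1 => //; apply: is_diff_radii => //; exact: ltnW.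
case=> Dx dE; split=> // v; rewrite dE /T big_split/=.
(* Summation by parts: the variation vanishes at both ends, and the two sums then align on the
   interior radii. *)
rewrite big_nat_recl// radii0 mulr0 add0r.
rewrite [X in _ + X]big_nat_recr//= radii_last mulr0 addr0.
rewrite -big_split/= big_nat big1// => j /andP[_ jk].
by rewrite -mulrDl addrC xcrit// mul0r.
Qed.

(** * Radii in geometric parametrization and the balance of adjacent cones *)

(* With [u = 2 y + l], [v = 2 y - l] and [r = u / v], the radius [h n l y] is
   [cosh_radius l r (r ^+ n.+1)]; consecutive radii correspond to [q] and
   [r * q]. *)
Definition cosh_radius (R : realType) (l r q : R) : R :=
  l / 2 * (q + r / q) / (r - 1).

(** The reflection exchanges [r ^+ n.+1] with the inverse of [r ^+ n]; this is the mirror symmetry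
    of the surface. *)
Lemma cosh_radius_sym (R : realType) (l r q : R) : r != 0 ->
  cosh_radius l r (r / q) = cosh_radius l r q.
Proof.
by move=> r0; rewrite /cosh_radius invf_div mulrCA divff// mulr1 addrC.
Qed.

(* The difference of consecutive radii is [l * sinh t] with [q = expR t], so
   that the slant height is [l * cosh t]. *)
Lemma slant_cosh_radius (R : realType) (l r q : R) : 0 < l -> 1 < r -> 0 < q ->
  Num.sqrt ((cosh_radius l r (r * q) - cosh_radius l r q) ^+ 2 + l ^+ 2) =
  l / 2 * (q + q^-1).
Proof.
move=> l0 r1 q0.
have r0 : r - 1 != 0 by rewrite subr_eq0 gt_eqF.
have rn0 : r != 0 by rewrite gt_eqF// (lt_trans ltr01).
have qn0 : q != 0 by rewrite gt_eqF.
have -> : (cosh_radius l r (r * q) - cosh_radius l r q) ^+ 2 + l ^+ 2 =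
    (l / 2 * (q + q^-1)) ^+ 2.
  by rewrite /cosh_radius; field; rewrite qn0 r0 rn0.
by rewrite sqrtr_sqr gtr0_norm// mulr_gt0// ?divr_gt0 ?addr_gt0 ?invr_gt0.
Qed.

Lemma dS1_cosh_radius_balance (R : realType) (l r q : R) :
    0 < l -> 1 < r -> 0 < q ->
  dS1 l (cosh_radius l r q) (cosh_radius l r (r * q)) +
  dS1 l (cosh_radius l r (r * (r * q))) (cosh_radius l r (r * q)) = 0.
Proof.
move=> l0 r1 q0; have r_gt0 : 0 < r := lt_trans ltr01 r1.
(* The second cone is traversed backwards; flipping its square makes [slant_cosh_radius] apply to
   both roots, which leaves a rational identity. *)
have slantC (x y : R) : (x - y) ^+ 2 = (y - x) ^+ 2 by ring.
rewrite /dS1 [X in _ + (Num.sqrt (X + _) + _ / Num.sqrt (X + _))]slantC.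
rewrite !slant_cosh_radius ?mulr_gt0// /cosh_radius.
have r0 : r - 1 != 0 by rewrite subr_eq0 gt_eqF.
have rn0 : r != 0 by rewrite gt_eqF.
have qn0 : q != 0 by rewrite gt_eqF.
have ln0 : l != 0 by rewrite gt_eqF.
have q1 : q * q + 1 != 0 by rewrite gt_eqF// addr_gt0// mulr_gt0.
have q2 : (r * q) * (r * q) + 1 != 0 by rewrite gt_eqF// addr_gt0// !mulr_gt0.
by field; rewrite ?rn0 ?r0 ?qn0 ?ln0 q1 q2.
Qed.

(** The power of exponent [m.+2] lies strictly above its tangent at [t]. The gap for [m.+1] is [s]
    times the gap for [m] plus a positive multiple of [(s - t) ^+ 2]. *)
Lemma weighted_AM_GM_lt (R : realFieldType) (m : nat) (s t : R) :
    0 < s -> 0 < t -> s != t ->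
  m.+2%:R * t ^+ m.+1 * s < s ^+ m.+2 + m.+1%:R * t ^+ m.+2.
Proof.
move=> s0 t0 st; rewrite -subr_gt0.
have st2 : 0 < (s - t) ^+ 2 by rewrite exprn_even_gt0//= subr_eq0.
elim: m => [|m IH]; first by rewrite [ltRHS](_ : _ = (s - t) ^+ 2)//; ring.
rewrite [ltRHS](_ : _ =
  s * (s ^+ m.+2 + m.+1%:R * t ^+ m.+2 - m.+2%:R * t ^+ m.+1 * s) +
  m.+2%:R * t ^+ m.+1 * (s - t) ^+ 2).
  apply: addr_gt0; first exact: mulr_gt0.
  by apply: mulr_gt0 => //; exact: mulr_gt0 (exprn_gt0 _ t0).
by rewrite -!natr1 !exprS; ring.
Qed.

(** * The closed form of the radii, from which the other forms are derived *)

Definition ptc_radius (R : realType) (n : nat) (l y : R) : R :=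
  ((2 * y + l) ^+ (2 * n + 1) + (2 * y - l) ^+ (2 * n + 1))
    / (4 * (4 * y ^+ 2 - l ^+ 2) ^+ n).

Lemma ptc_radiusE (R : realType) (n : nat) (l y : R) : 0 < l -> l / 2 < y ->
  let r := (2 * y + l) / (2 * y - l) in
  ptc_radius n l y = cosh_radius l r (r ^+ n.+1).
Proof.
move=> l0 yl /=; rewrite /ptc_radius /cosh_radius.
have -> : 4 * y ^+ 2 - l ^+ 2 = (2 * y + l) * (2 * y - l) by ring.
(* Eliminating [l] leaves a rational identity in two independent variables [u] and [v]. *)
have -> : l = ((2 * y + l) - (2 * y - l)) / 2 by field.
have -> : 2 * y + ((2 * y + l) - (2 * y - l)) / 2 = 2 * y + l by field.
have -> : 2 * y - ((2 * y + l) - (2 * y - l)) / 2 = 2 * y - l by field.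
have u0 : 2 * y + l != 0 by rewrite gt_eqF//; lra.
have v0 : 2 * y - l != 0 by rewrite gt_eqF//; lra.
have uv : 2 * y + l - (2 * y - l) != 0 by rewrite gt_eqF//; lra.
move: (2 * y + l) (2 * y - l) u0 v0 uv => u v u0 v0 uv.
rewrite addn1 mul2n -addnn !exprS !exprD !exprMn exprVn.
have un0 : u ^+ n != 0 by rewrite expf_neq0.
have vn0 : v ^+ n != 0 by rewrite expf_neq0.
by field; rewrite mulN1r v0 uv vn0 un0 u0.
Qed.

(** * Chebyshev and hypergeometric forms *)

Definition hyp_coef (R : realType) (n i : nat) : R :=
  (- 4) ^+ i * 'C(n + i, 2 * i)%:R.

(** Induction on [i], comparing the ratios of successive coefficients. *)
Lemma hyp_coefE (R : realType) (n i : nat) :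
  rising (n%:R + 1) i * rising (- n%:R) i / (rising (1 / 2) i * rising 1 i)
  = hyp_coef R n i.
Proof.
rewrite /hyp_coef /rising; elim: i => [|i IH].
  by rewrite !big_geq// muln0 bin0 expr0 !mulr1 invr1 mulr1.
have pos (c : R) : 0 < c -> \prod_(0 <= j < i) (c + j%:R) != 0.
  by move=> c0; rewrite gt_eqF// prodr_gt0// => j _; rewrite ltr_wpDr.
have h0 := pos (1 / 2) ltac:(by rewrite divr_gt0).
have h1 := pos 1 ltr01.
have h3 : 1 + i%:R != 0 :> R by rewrite gt_eqF// ltr_wpDr.
rewrite !big_nat_recr//=.
set p := \prod_(0 <= j < i) (n%:R + 1 + _) in IH *.
set p' := \prod_(0 <= j < i) (- _ + _) in IH *.
move: IH h0 h1; set q := \prod_(0 <= j < i) _; set q' := \prod_(0 <= j < i) _.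
move=> IH h0 h1.
rewrite [LHS](_ : _ = p * p' / (q * q') *
    ((n%:R + 1 + i%:R) * (- n%:R + i%:R) / ((1 / 2 + i%:R) * (1 + i%:R))));
  last by rewrite !invfM; ring.
(* From [i = n] on, both sides vanish at [i.+1]: the series terminates. *)
rewrite IH; have [ni|ni] := leqP n i.
  rewrite [X in _ = _ * X%:R]bin_small; last by lia.
  move: ni; rewrite leq_eqVlt => /orP[/eqP->|ni]; first by rewrite addNr; ring.
  by rewrite bin_small; [ring|lia].
have : ('C(n + i.+1, 2 * i.+1) * (2 * i + 2) * (2 * i + 1) =
    'C(n + i, 2 * i) * (n + 1 + i) * (n - i))%N.
  have := mul_bin_diag (n + i).+1 (2 * i).+1.
  have := mul_bin_left (n + i) (2 * i).
  rewrite (_ : (n + i - 2 * i = n - i)%N); last by lia.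
  rewrite ?mulnS ?addnS ?addSn ?add0n ?addn0/=.
  by move=> E1 E2; rewrite -mulnA mulnCA; nia.
move/(congr1 (fun k : nat => k%:R : R));
rewrite !(natrM, natrD) natrB ?(ltnW ni)// => E.
rewrite exprS.
have c0 : 2 * i%:R + 2 != 0 :> R by rewrite gt_eqF// ltr_wpDl ?mulr_ge0.
have c1 : 2 * i%:R + 1 != 0 :> R by rewrite gt_eqF// ltr_wpDl ?mulr_ge0.
have -> : 'C(n + i.+1, 2 * i.+1)%:R = 'C(n + i, 2 * i)%:R * (n%:R + 1 + i%:R) *
  (n%:R - i%:R) / ((2 * i%:R + 2) * (2 * i%:R + 1)) :> R.
  by rewrite -E; field; rewrite c0 c1.
by field; rewrite c0 c1 h3.
Qed.

(** The Chebyshev recurrence at [1 - 2 * z], read off coefficientwise; it reduces to Pascal's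
    rule. *)
Lemma hyp_coefS (R : realType) (n i : nat) :
  hyp_coef R n.+2 i.+1 =
  2 * hyp_coef R n.+1 i.+1 - 4 * hyp_coef R n.+1 i - hyp_coef R n i.+1.
Proof.
rewrite /hyp_coef !exprS.
have : ('C(n.+2 + i.+1, 2 * i.+1) + 'C(n + i.+1, 2 * i.+1) =
  2 * 'C(n.+1 + i.+1, 2 * i.+1) + 'C(n.+1 + i, 2 * i))%N.
  have -> : (2 * i.+1 = (2 * i).+2)%N by lia.
  have -> : (n.+2 + i.+1 = (n + i).+3)%N by lia.
  have -> : (n.+1 + i.+1 = (n + i).+2)%N by lia.
  have -> : (n.+1 + i = (n + i).+1)%N by lia.
  have -> : (n + i.+1 = (n + i).+1)%N by lia.
  by rewrite !binS; lia.
move/(congr1 (fun k : nat => k%:R : R)); rewrite natrD [in RHS]natrD natrM => E.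
have -> : 'C(n.+2 + i.+1, 2 * i.+1)%:R =
 2%:R * 'C(n.+1 + i.+1, 2 * i.+1)%:R + 'C(n.+1 + i, 2 * i)%:R
 - 'C(n + i.+1, 2 * i.+1)%:R :> R by rewrite -E addrK.
by ring.
Qed.

Lemma hyp_coef0 (R : realType) (n : nat) : hyp_coef R n 0 = 1.
Proof. by rewrite /hyp_coef muln0 bin0 expr0 mulr1. Qed.

Lemma hyp_coef_small (R : realType) (n i : nat) :
  (n < i)%N -> hyp_coef R n i = 0.
Proof. by move=> ni; rewrite /hyp_coef bin_small ?mulr0//; lia. Qed.

Lemma chebyshev3SS (R : realType) (n : nat) (x : R) :
  (chebyshev3 R n.+2).[x] =
  2 * x * (chebyshev3 R n.+1).[x] - (chebyshev3 R n).[x].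
Proof. by rewrite [chebyshev3 R n.+2]/= !hornerE. Qed.

Lemma chebyshev3_hyp_sum (R : realType) (n N : nat) (z : R) : (n < N)%N ->
  (chebyshev3 R n).[1 - 2 * z] = \sum_(0 <= i < N) hyp_coef R n i * z ^+ i.
Proof.
elim/ltn_ind: n N => -[|[|n]] IH N.
- case: N => // N _; rewrite big_nat_recl// hyp_coef0 big1 => [|i _].
    by rewrite /= !hornerE.
  by rewrite hyp_coef_small// mul0r.
- case: N => [|[|N]]// _; rewrite !big_nat_recl// hyp_coef0 big1 => [|i _].
    by rewrite /= !hornerE /hyp_coef muln1 addn1 binn /=; ring.
  by rewrite hyp_coef_small// mul0r.
case: N => // N nN.
(* The factor [z] in the recurrence shifts the index, so the sum for [n.+1] is needed at both
   lengths [N] and [N.+1]; hence the free truncation. *)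
have IH1N := IH n.+1 ltac:(lia) N ltac:(lia).
have := IH n.+1 ltac:(lia) N.+1 ltac:(lia).
rewrite big_nat_recl// hyp_coef0 expr0 mulr1 => V1.
have := IH n ltac:(lia) N.+1 ltac:(lia).
rewrite big_nat_recl// hyp_coef0 expr0 mulr1 => V0.
rewrite chebyshev3SS big_nat_recl// hyp_coef0 expr0 mulr1.
rewrite [in RHS](eq_bigr (fun i => 2 * (hyp_coef R n.+1 i.+1 * z ^+ i.+1) -
    4 * z * (hyp_coef R n.+1 i * z ^+ i) - hyp_coef R n i.+1 * z ^+ i.+1)).
  2: by move=> i _; rewrite hyp_coefS [z ^+ _.+1]exprS; ring.
rewrite !sumrB -!mulr_sumr -IH1N V0.
have {V1}-> : \sum_(0 <= i < N) hyp_coef R n.+1 i.+1 * z ^+ i.+1 =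
    (chebyshev3 R n.+1).[1 - 2 * z] - 1 by rewrite V1 [1 + _]addrC addrK.
by ring.
Qed.

Lemma hypergeometric_chebyshev3 (R : realType) (n : nat) (z : R) :
  hypergeometric (n%:R + 1) (- n%:R) (1 / 2) z = (chebyshev3 R n).[1 - 2 * z].
Proof.
apply: lim_near_cst; first exact: Rhausdorff.
near=> N; rewrite /series/=.
under eq_bigr do rewrite hyp_coefE.
rewrite (@chebyshev3_hyp_sum _ _ N)//.
by near: N; exact: nbhs_infty_gt.
Unshelve. all: by end_near. Qed.

(** With [r = u / v] the argument is [(r + r^-1) / 2], so powers of [r] and of [r^-1] both solve the
    Chebyshev recurrence, and so does the closed form. *)
Lemma ptc_radius_chebyshev3 (R : realType) (n : nat) (l y : R) :
  0 < l -> l / 2 < y ->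
  ptc_radius n l y =
  y * (chebyshev3 R n).[1 + 2 * l ^+ 2 / (4 * y ^+ 2 - l ^+ 2)].
Proof.
move=> l0 yl.
have u0 : 2 * y + l != 0 by rewrite gt_eqF//; lra.
have v0 : 2 * y - l != 0 by rewrite gt_eqF//; lra.
have uv0 : 4 * y ^+ 2 - l ^+ 2 != 0.
  by rewrite (_ : _ - _ = (2 * y + l) * (2 * y - l)) ?mulf_neq0//; ring.
elim/ltn_ind: n => -[|[|n]] IH.
- by rewrite /ptc_radius muln0 add0n /= !hornerE /=; field.
- rewrite /ptc_radius -[(2 * 1 + 1)%N]/3%N /= !hornerE /=; field.
  by rewrite -mulrA.
rewrite chebyshev3SS mulrBr mulrCA -!IH// /ptc_radius.
rewrite (_ : (2 * n.+2 + 1 = 4 + (2 * n + 1))%N); last by lia.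
rewrite (_ : (2 * n.+1 + 1 = 2 + (2 * n + 1))%N); last by lia.
rewrite -[n.+2]/(2 + n)%N -[n.+1]/(1 + n)%N !exprD.
have w0 : (4 * y ^+ 2 - l ^+ 2) ^+ n != 0 by rewrite expf_neq0.
move: w0; set p := (2 * y + l) ^+ n; set q := (2 * y - l) ^+ n.
set w := _ ^+ n => w0.
by field; rewrite w0 uv0.
Qed.

(** * Positivity, strict convexity and the two solutions *)

Lemma ptc_radius_gt0 (R : realType) (n : nat) (l y : R) :
  0 < l -> l / 2 < y -> 0 < ptc_radius n l y.
Proof.
move=> l0 yl.
have u0 : 0 < 2 * y + l by lra.
have v0 : 0 < 2 * y - l by lra.
rewrite /ptc_radius (_ : 4 * y ^+ 2 - l ^+ 2 = (2 * y + l) * (2 * y - l));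
  last by ring.
by rewrite divr_gt0 ?addr_gt0 ?mulr_gt0 ?exprn_gt0// mulr_gt0.
Qed.

Lemma ptc_radius_split (R : realType) (n : nat) (l y : R) :
    0 < l -> l / 2 < y ->
  4 * ptc_radius n l y =
  (2 * y + l) * ((2 * y + l) / (2 * y - l)) ^+ n +
  (2 * y - l) * ((2 * y - l) / (2 * y + l)) ^+ n.
Proof.
move=> l0 yl; rewrite /ptc_radius.
have -> : 4 * y ^+ 2 - l ^+ 2 = (2 * y + l) * (2 * y - l) by ring.
have u0 : 2 * y + l != 0 by rewrite gt_eqF//; lra.
have v0 : 2 * y - l != 0 by rewrite gt_eqF//; lra.
move: (2 * y + l) (2 * y - l) u0 v0 => u v u0 v0.
have un0 : u ^+ n != 0 by rewrite expf_neq0.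
have vn0 : v ^+ n != 0 by rewrite expf_neq0.
rewrite addn1 mul2n -addnn !exprS !exprD !exprMn !exprVn.
by field; rewrite vn0 un0.
Qed.

(** The bound [u ^+ 2 / v] does not depend on [m] and blows up both as [y] tends to [l / 2] and at
    infinity. *)
Lemma ptc_radius_gt (R : realType) (m : nat) (l y : R) :
    (1 <= m)%N -> 0 < l -> l / 2 < y ->
  (2 * y + l) * ((2 * y + l) / (2 * y - l)) < 4 * ptc_radius m l y.
Proof.
move=> m1 l0 yl.
have u0 : 0 < 2 * y + l by lra.
have v0 : 0 < 2 * y - l by lra.
rewrite ptc_radius_split// ltr_pwDr ?mulr_gt0 ?exprn_gt0 ?divr_gt0//.
rewrite ler_pM2l// ler_eXnr// ler_pdivlMr//; lra.
Qed.

(** The tangent inequality for powers at [s = u / v], multiplied by [v]: its left side becomes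
    linear in [u] and [v]. *)
Lemma perspective_tangent (R : realFieldType) (m : nat) (u v t : R) :
    0 < u -> 0 < v -> 0 < t -> u / v != t ->
  m.+2%:R * t ^+ m.+1 * u - m.+1%:R * t ^+ m.+2 * v < u * (u / v) ^+ m.+1.
Proof.
move=> u0 v0 t0 uvt; have vn0 : v != 0 by rewrite gt_eqF.
have := weighted_AM_GM_lt m (divr_gt0 u0 v0) t0 uvt.
rewrite -(ltr_pM2l v0) -subr_gt0 [(u / v) ^+ m.+2]exprS => /lt_le_trans H.
rewrite -subr_gt0; apply: H.
by rewrite le_eqVlt; apply/orP; left; apply/eqP; field.
Qed.

(** A strict supporting line at each point expresses strict convexity without derivatives. *)
Lemma ptc_radius_tangent (R : realType) (m : nat) (l y0 : R) :
    (1 <= m)%N -> 0 < l -> l / 2 < y0 ->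
  exists c d : R, ptc_radius m l y0 = c * y0 + d /\
    forall y, l / 2 < y -> y != y0 -> c * y + d < ptc_radius m l y.
Proof.
case: m => // m _ l0 yl0.
have u0_gt0 : 0 < 2 * y0 + l by lra.
have v0_gt0 : 0 < 2 * y0 - l by lra.
set u0 := 2 * y0 + l in u0_gt0 *; set v0 := 2 * y0 - l in v0_gt0 *.
pose t := u0 / v0; pose k := v0 / u0.
(* [A] and [B] are the coefficients of [u] and [v] in the sum of the two perspective tangents. *)
pose A := m.+2%:R * t ^+ m.+1 - m.+1%:R * k ^+ m.+2.
pose B := m.+2%:R * k ^+ m.+1 - m.+1%:R * t ^+ m.+2.
have t_gt0 : 0 < t by exact: divr_gt0.
have k_gt0 : 0 < k by exact: divr_gt0.
(* This is [(A * u + B * v) / 4] expanded in [y]. *)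
exists ((A + B) / 2), (l * (A - B) / 4); split=> [|y yl yy0].
  apply: (@mulfI _ 4) => //; rewrite ptc_radius_split// -/u0 -/v0 -/t -/k.
  have uE : u0 = t * v0 by rewrite /t divfK// gt_eqF.
  have vE : v0 = k * u0 by rewrite /k divfK// gt_eqF.
  rewrite [RHS](_ : _ = A * u0 + B * v0); last by rewrite /u0 /v0; field.
  rewrite /A /B [t ^+ m.+2]exprS [k ^+ m.+2]exprS.
  rewrite [RHS](_ : _ = m.+2%:R * (t ^+ m.+1 * u0 + k ^+ m.+1 * v0) -
    m.+1%:R * (t ^+ m.+1 * (t * v0) + k ^+ m.+1 * (k * u0))); last by ring.
  by rewrite -uE -vE -[m.+2]addn1 natrD; ring.
rewrite -(@ltr_pM2l _ 4)// ptc_radius_split//.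
have u_gt0 : 0 < 2 * y + l by lra.
have v_gt0 : 0 < 2 * y - l by lra.
(* The ratio [u / v] determines [y], so both tangent inequalities are strict away from [y0]. *)
have neq1 : (2 * y + l) / (2 * y - l) != t.
  rewrite /t eqr_div ?lt0r_neq0// -subr_eq0 /u0 /v0.
  rewrite (_ : _ - _ = 4 * l * (y0 - y)); last by ring.
  by apply: mulf_neq0; [rewrite lt0r_neq0// mulr_gt0|rewrite subr_eq0 eq_sym].
have neq2 : (2 * y - l) / (2 * y + l) != k.
  by rewrite /k -[v0 / u0]invf_div -[_ / (2 * y + l)]invf_div (inj_eq invr_inj).
have := ltrD (perspective_tangent m u_gt0 v_gt0 t_gt0 neq1)
  (perspective_tangent m v_gt0 u_gt0 k_gt0 neq2).
apply: le_lt_trans; rewrite le_eqVlt; apply/orP; left; apply/eqP.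
by rewrite /A /B; field.
Qed.

Lemma ptc_radius_ivt (R : realType) (m : nat) (l a y1 y2 : R) :
    0 < l -> l / 2 < y1 -> y1 <= y2 ->
    ptc_radius m l y1 <= a <= ptc_radius m l y2 \/
    ptc_radius m l y2 <= a <= ptc_radius m l y1 ->
  exists2 y, y1 <= y <= y2 & ptc_radius m l y = a.
Proof.
move=> l0 yl1 y12.
(* Clearing the positive denominator [w] reduces the claim to the intermediate value theorem for
   polynomials. *)
pose p : {poly R} := (2%:P * 'X + l%:P) ^+ (2 * m + 1) +
  (2%:P * 'X - l%:P) ^+ (2 * m + 1) -
  (4 * a)%:P * (4%:P * 'X ^+ 2 - (l ^+ 2)%:P) ^+ m.
pose w y := 4 * (4 * y ^+ 2 - l ^+ 2) ^+ m.
have w_gt0 y : y1 <= y -> 0 < w y.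
  move=> y1y; rewrite /w mulr_gt0// exprn_gt0//.
  rewrite (_ : _ - _ = (2 * y + l) * (2 * y - l)); last by ring.
  by rewrite mulr_gt0//; lra.
have pE y : y1 <= y -> p.[y] = w y * (ptc_radius m l y - a).
  move=> /w_gt0 wy; rewrite mulrBr /ptc_radius -/(w y) mulrC divfK ?gt_eqF//.
  by rewrite /p !hornerE /w /= -[4 * y * y]mulrA -expr2; ring.
have root_ptc y : y1 <= y -> root p y -> ptc_radius m l y = a.
  move=> y1y; rewrite rootE pE// mulf_eq0 gt_eqF ?w_gt0//= subr_eq0.
  by move/eqP.
have le1 := lexx y1.
case=> /andP[h1 h2].
  have [||y /andP[y1y yy2] py] := @poly_ivt R p y1 y2 => //.
    rewrite !pE// pmulr_rle0 ?w_gt0// pmulr_rge0 ?w_gt0//.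
    by rewrite subr_le0 subr_ge0 h1.
  by exists y; rewrite ?y1y// root_ptc.
have [||y /andP[y1y yy2]] := @poly_ivt R (- p) y1 y2 => //.
  rewrite !hornerN oppr_le0 oppr_ge0 !pE// pmulr_rle0 ?w_gt0//.
  by rewrite pmulr_rge0 ?w_gt0// subr_le0 subr_ge0 h1 h2.
by rewrite rootN => py; exists y; rewrite ?y1y// root_ptc.
Qed.

Lemma ptc_radius_two_solutions (R : realType) (m : nat) (l a : R) :
    (1 <= m)%N -> 0 < l -> ptc_radius m l l < a ->
  exists ym yp : R, [/\ l / 2 < ym, ym < yp, ptc_radius m l ym = a,
    ptc_radius m l yp = a &
    forall y, l / 2 < y -> ptc_radius m l y = a -> y = ym \/ y = yp].
Proof.
move=> m1 l0 la.
have ll : l / 2 < l by lra.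
have a0 : 0 < a := lt_trans (ptc_radius_gt0 m l0 ll) la.
(* At [b] one has [u > 2 * l] and [v <= l ^+ 2 / a], so [u ^+ 2 / v] exceeds [4 * a]. *)
pose b := Num.min l (l / 2 + l ^+ 2 / (2 * a)).
have bl : b <= l by rewrite ge_min lexx.
have b0 : l / 2 < b by rewrite lt_min ll ltrDl divr_gt0 ?exprn_gt0 ?mulr_gt0.
have hb : a <= ptc_radius m l b.
  have := ptc_radius_gt m1 l0 b0 => /ltW.
  rewrite -[a <= _](ler_pM2l (_ : 0 < 4)) //; apply: le_trans.
  rewrite mulrA ler_pdivlMr; last by lra.
  have : b <= l / 2 + l ^+ 2 / (2 * a) by rewrite ge_min lexx orbT.
  rewrite -lerBlDl ler_pdivlMr ?mulr_gt0// => H.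
  by nra.
have [ym /andP[bym yml] hym] : exists2 y, b <= y <= l & ptc_radius m l y = a.
  by apply: ptc_radius_ivt => //; right; rewrite hb ltW.
(* At [c] one has [u ^+ 2 / v > u > 4 * a]. *)
pose c := l + 2 * a.
have hc : a <= ptc_radius m l c.
  have cl : l / 2 < c by rewrite /c; lra.
  have := ptc_radius_gt m1 l0 cl => /ltW.
  rewrite -[a <= _](ler_pM2l (_ : 0 < 4)) //; apply: le_trans.
  rewrite mulrA ler_pdivlMr /c; last by lra.
  by nra.
have [yp /andP[lyp _] hyp] : exists2 y, l <= y <= c & ptc_radius m l y = a.
  by apply: ptc_radius_ivt => //; [rewrite /c; lra|left; rewrite hc ltW].
have ymb : l / 2 < ym := lt_le_trans b0 bym.
have ypb : l / 2 < yp := lt_le_trans ll lyp.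
have ml : ym < l.
  rewrite lt_neqAle yml andbT; apply: contraTneq la => yl.
  by rewrite -{2}yl hym ltxx.
(* The supporting line at the middle point would have to drop strictly on both sides, whatever the
   sign of its slope. *)
have no3 y1 y2 y3 : l / 2 < y1 -> y1 < y2 -> y2 < y3 ->
    ptc_radius m l y1 = a -> ptc_radius m l y2 = a -> ptc_radius m l y3 = a ->
    False.
  move=> yl1 y12 y23 h1 h2 h3.
  have [C [D [E T]]] := ptc_radius_tangent m1 l0 (lt_trans yl1 y12).
  have := T y1 yl1 (negbT (lt_eqF y12)).
  have := T y3 (lt_trans yl1 (lt_trans y12 y23)) (negbT (gt_eqF y23)).
  rewrite h1 h3 -h2 E !ltrD2r => E3 E1.
  have [C0|C0] := leP 0 C.
    by move: E3; rewrite ltNge ler_wpM2l// ltW.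
  by move: E1; rewrite ltNge ler_wnM2l// ltW.
have mp : ym < yp by exact: lt_le_trans lyp.
exists ym, yp; split=> // y yl hy.
have [yym|yym|->] := ltgtP y ym; last by left.
  by case: (no3 y ym yp).
have [yyp|yyp|->] := ltgtP y yp; last by right.
  by case: (no3 ym y yp).
by case: (no3 ym yp y).
Qed.

(** * Minimality of the mirrored surface *)

(** The boundary radius is absorbed as [y m], so one formula covers all indices from 0 to
    [2 * m + 1]. *)
Lemma radii_mirror (R : realType) (m : nat) (a : R) (y : nat -> R) (i : nat) :
    (1 <= m)%N -> y m = a -> (i <= (2 * m).-1.+2)%N ->
  radii a (mirror m y) a i = if (i <= m)%N then y (m - i)%N else y (i - m.+1)%N.
Proof.
move=> m1 ym; case: i => [_|i]; first by rewrite radii0 subn0.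
rewrite ltnS leq_eqVlt => /orP[/eqP->|ik].
  rewrite radii_last ifF; last by lia.
  by rewrite -ym; congr y; lia.
rewrite -[i in LHS]/(val (Ordinal ik)) radii_inner mxE/=.
rewrite nth_cat size_rev size_mkseq; case: ifP => im.
  by rewrite nth_rev ?size_mkseq// nth_mkseq//; lia.
by rewrite nth_mkseq//; lia.
Qed.

Lemma minimal_mirror (R : realType) (m : nat) (l y : R) :
    (1 <= m)%N -> 0 < l -> l / 2 < y ->
  minimal_PTC l (ptc_radius m l y) (mirror m (fun n => ptc_radius n l y))
    (ptc_radius m l y).
Proof.
move=> m1 l0 yl; set a := ptc_radius m l y; set x := mirror m _.
have u0 : 0 < 2 * y + l by lra.
have v0 : 0 < 2 * y - l by lra.
pose r := (2 * y + l) / (2 * y - l).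
have r1 : 1 < r by rewrite ltr_pdivlMr//; lra.
have r0 : 0 < r := lt_trans ltr01 r1.
(* All radii, boundary included, follow one geometric progression of ratio [r]; the quotient stands
   for the exponent [i - m], negative on the first half, where the reflection is used. *)
have rE i : (i <= (2 * m).-1.+2)%N ->
    radii a x a i = cosh_radius l r (r ^+ i / r ^+ m).
  move=> ik; rewrite radii_mirror// !ptc_radiusE// -/r; case: ifP => im.
    rewrite -[RHS]cosh_radius_sym ?lt0r_neq0//; congr cosh_radius.
    have [d ->] : exists d, m = (i + d)%N by exists (m - i)%N; lia.
    have ri : r ^+ i != 0 by rewrite lt0r_neq0// exprn_gt0.
    have rd : r ^+ d != 0 by rewrite lt0r_neq0// exprn_gt0.
    by rewrite addnC addnK exprS exprD; field; rewrite ri rd.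
  congr cosh_radius.
  have [d ->] : exists d, i = (m + d.+1)%N by exists (i - m.+1)%N; lia.
  have rm : r ^+ m != 0 by rewrite lt0r_neq0// exprn_gt0.
  by rewrite addnS -addSn addnC addnK addnS -addSn exprD mulfK.
split=> //; do ?exact: ptc_radius_gt0.
  move=> j; have jm := ltn_ord j; rewrite mxE nth_cat size_rev size_mkseq.
  by case: ifP => ?;
    rewrite ?nth_rev ?size_mkseq ?nth_mkseq ?ptc_radius_gt0//; lia.
apply: critical_SN => // j jk.
rewrite !rE; try lia.
rewrite !exprS -!(mulrA r); apply: dS1_cosh_radius_balance => //.
by rewrite divr_gt0// exprn_gt0.
Qed.

Theorem theorem2p4 (R : realType) :
  exists (h : nat -> R -> R -> R) (nu : nat -> R -> R),
    (forall (m : nat) (l a : R), (1 <= m)%N -> 0 < l -> nu m l < a ->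
       exists ym yp : R,
         [/\ l / 2 < ym, ym < yp,
             (forall y : R, l / 2 < y ->
                (h m l y - a = 0 <-> y = ym \/ y = yp)),
             minimal_PTC l a (mirror m (fun n => h n l ym)) a &
             minimal_PTC l a (mirror m (fun n => h n l yp)) a]) /\
    (forall (n : nat) (l y : R), 0 < l -> l / 2 < y ->
       [/\ h n l y =
             y * (chebyshev3 R n).[1 + 2 * l ^+ 2 / (4 * y ^+ 2 - l ^+ 2)],
           h n l y =
             y * hypergeometric (n%:R + 1) (- n%:R) (1 / 2)
                   (- l ^+ 2 / (4 * y ^+ 2 - l ^+ 2)) &
           h n l y =
             ((2 * y + l) ^+ (2 * n + 1) + (2 * y - l) ^+ (2 * n + 1))
               / (4 * (4 * y ^+ 2 - l ^+ 2) ^+ n)]).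
Proof.
exists (@ptc_radius R), (fun m l => ptc_radius m l l); split.
  move=> m l a m1 l0 /(ptc_radius_two_solutions m1 l0).
  case=> ym [yp [ylm mp hm hp only]]; exists ym, yp; split=> //.
  - move=> y yl; split=> [/eqP|]; first by rewrite subr_eq0 => /eqP/only; exact.
    by case=> ->; rewrite ?hm ?hp subrr.
  - by rewrite -hm; exact: minimal_mirror.
  - by rewrite -hp; apply: minimal_mirror => //; exact: lt_trans mp.
move=> n l y l0 yl; split=> //; first exact: ptc_radius_chebyshev3.
rewrite hypergeometric_chebyshev3 ptc_radius_chebyshev3//.
by congr (y * _.[_]); rewrite mulNr mulrN opprK mulrA.
Qed.
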